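(* Let $M$ be a Riesz monoid in which there is an order-unit of finite stable rank. Then $S_{\omega_1}$ is not isomorphic to $\nabla(M)$.
   Context: All monoids are commutative and written additively. A commutative monoid $M$ is endowed with its algebraic quasi-ordering: $x\leq y$ iff there is $z\in M$ with $x+z=y$. $\mathbb{N}$ denotes the set of positive integers. $M$ is a Riesz monoid if whenever $c\leq a+b$ in $M$ there are $a'\leq a$ and $b'\leq b$ in $M$ with $c=a'+b'$. Put $a\propto b$ iff $a\leq nb$ for some $n\in\mathbb{N}$, and $a\asymp b$ iff $a\propto b$ and $b\propto a$. Then $\asymp$ is a monoid congruence and $\nabla(M)=M/{\asymp}$ is a join-semilattice with zero (join induced by $+$), the maximal semilattice quotient of $M$. An element $e\in M$ is an order-unit if $x\propto e$ for all $x\in M$. For $k\in\mathbb{N}$, an element $e\in M$ has stable rank at most $k$ if $ke+a=e+b$ implies $a\leq b$, for all $a,b\in M$; it has finite stable rank if this holds for some $k\in\mathbb{N}$. The semilattice $S_{\omega_1}$: ordinals are identified with the set of smaller ordinals. Let $\mathcal{B}_{\omega_1}$ be the Boolean subalgebra of the powerset of $\omega_1$ generated by all intervals of $\omega_1$. Put $\mathcal{I}_{\omega_1}=\{x\in\mathcal{B}_{\omega_1}\mid \exists\alpha<\omega_1,\ x\subseteq\alpha\}$, $\mathcal{F}_{\omega_1}=\{x\in\mathcal{B}_{\omega_1}\mid \exists\alpha<\omega_1,\ \omega_1\setminus\alpha\subseteq x\}$, $D_{\omega_1}=\{x\subseteq\omega_1\mid x\text{ is finite or }x=\omega_1\}$,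 and $D_{\omega_1}^-=D_{\omega_1}\setminus\{\varnothing\}$. Then $S_{\omega_1}=(\{\varnothing\}\times\mathcal{I}_{\omega_1})\cup(D_{\omega_1}^-\times\mathcal{F}_{\omega_1})$, ordered by componentwise inclusion; it is a distributive join-semilattice with $0$ and $1$ (joins are componentwise unions). *)

(* Defs.v *)
From HB Require Import structures.
From mathcomp Require Import all_boot all_order all_algebra.
From mathcomp Require Import wochoice all_classical.

Set Implicit Arguments.
Unset Strict Implicit.
Unset Printing Implicit Defensive.

Import Order.TTheory GRing.Theory.

Local Open Scope classical_set_scope.
Local Open Scope ring_scope.
Local Open Scope quotient_scope.

Section CommutativeMonoids.
Variable M : nmodType.
Implicit Types a b c e x y : M.

Definition algle x y : Prop := exists z, x + z = y.

Definition riesz_monoid : Prop :=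
  forall a b c, algle c (a + b) ->
    exists a' b', [/\ algle a' a, algle b' b & c = a' + b'].

Definition propto a b : Prop := exists n : nat, (0 < n)%N /\ algle a (b *+ n).

Definition asymp a b : Prop := propto a b /\ propto b a.

Definition order_unit e : Prop := forall x, propto x e.

Definition stable_rank_le (k : nat) e : Prop :=
  forall a b, e *+ k + a = e + b -> algle a b.

Definition finite_stable_rank e : Prop :=
  exists k : nat, (0 < k)%N /\ stable_rank_le k e.

Lemma algle_refl x : algle x x.
Proof. by exists 0; rewrite addr0. Qed.

Lemma algle_trans y x z : algle x y -> algle y z -> algle x z.
Proof. by move=> [u <-] [v <-]; exists (u + v); rewrite addrA. Qed.

Lemma algleD a b c e : algle a b -> algle c e -> algle (a + c) (b + e).
Proof. by move=> [u <-] [v <-]; exists (u + v); rewrite addrACA. Qed.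

Lemma algleMn n x y : algle x y -> algle (x *+ n) (y *+ n).
Proof. by move=> [u <-]; exists (u *+ n); rewrite mulrnDl. Qed.

Lemma propto_refl x : propto x x.
Proof. by exists 1%N; split => //; exact: algle_refl. Qed.

Lemma propto_trans y x z : propto x y -> propto y z -> propto x z.
Proof.
move=> [n [n0 xy]] [m [m0 yz]]; exists (m * n)%N; split; first by rewrite muln_gt0 m0.
by apply: (algle_trans xy); rewrite mulrnA; exact: algleMn.
Qed.

Lemma propto0 x : propto 0 x.
Proof. by exists 1%N; split=> //; exists x; rewrite add0r. Qed.

Lemma propto_addl x y : propto x (x + y).
Proof. by exists 1%N; split => //; exists y. Qed.

Lemma propto_addr x y : propto y (x + y).
Proof. by rewrite addrC; exact: propto_addl. Qed.

Lemma propto_add x y z : propto x z -> propto y z -> propto (x + y) z.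
Proof.
move=> [n [n0 xz]] [m [m0 yz]]; exists (n + m)%N; split; first by rewrite addn_gt0 n0.
by rewrite mulrnDr; exact: algleD.
Qed.

Definition asympb : rel M := fun a b => `[< asymp a b >].

Lemma asympb_refl : reflexive asympb.
Proof. by move=> x; apply/asboolP; split; exact: propto_refl. Qed.

Lemma asympb_sym : symmetric asympb.
Proof. by move=> x y; apply/asboolP/asboolP => -[]. Qed.

Lemma asympb_trans : transitive asympb.
Proof.
move=> y x z /asboolP[xy yx] /asboolP[yz zy].
by apply/asboolP; split; [exact: (propto_trans xy)|exact: (propto_trans zy)].
Qed.

Definition asymp_equiv : equiv_rel M :=
  EquivRel asympb asympb_refl asympb_sym asympb_trans.

Definition nabla : Type := {eq_quot asymp_equiv}.

End CommutativeMonoids.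

Fact nabla_display : Order.disp_t. Proof. exact: (Order.Disp tt tt). Qed.

Section Nabla.
Variable M : nmodType.

HB.instance Definition _ := Choice.on (nabla M).

HB.instance Definition _ := EqQuotient.on (nabla M).

Definition nabla_pi (a : M) : nabla M := \pi_(nabla M) a.

Lemma nabla_eqP (a b : M) : reflect (asymp a b) (nabla_pi a == nabla_pi b).
Proof. by rewrite eqmodE; exact: asboolP. Qed.

Lemma nabla_piP (x : nabla M) : exists a, x = nabla_pi a.
Proof. by exists (repr x); rewrite /nabla_pi reprK. Qed.

Lemma repr_asymp (a : M) : asymp (repr (nabla_pi a)) a.
Proof. by apply/nabla_eqP; rewrite /nabla_pi reprK. Qed.

(* The order and the join are given on chosen representatives; [nabla_leE] and
   [nabla_joinE] show that they do not depend on the choice. *)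
Definition nabla_le (x y : nabla M) : bool := `[< propto (repr x) (repr y) >].

Definition nabla_join (x y : nabla M) : nabla M :=
  nabla_pi (repr x + repr y).

Lemma nabla_le_refl : reflexive nabla_le.
Proof. by move=> x; apply/asboolP; exact: propto_refl. Qed.

Lemma nabla_le_anti : antisymmetric nabla_le.
Proof.
move=> x y /andP[/asboolP xy /asboolP yx].
by rewrite -[x]reprK -[y]reprK; apply/eqP/nabla_eqP.
Qed.

Lemma nabla_le_trans : transitive nabla_le.
Proof.
by move=> y x z /asboolP xy /asboolP yz; apply/asboolP; exact: (propto_trans xy).
Qed.

HB.instance Definition _ := Order.Le_isPOrder.Build nabla_display (nabla M)
  nabla_le_refl nabla_le_anti nabla_le_trans.

Lemma nabla_leE (a b : M) : (nabla_pi a <= nabla_pi b)%O = `[< propto a b >].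
Proof.
have [ra ar] := repr_asymp a; have [rb br] := repr_asymp b.
apply/asboolP/asboolP => ab.
- exact: (propto_trans ar (propto_trans ab rb)).
- exact: (propto_trans ra (propto_trans ab br)).
Qed.

Lemma nabla_join_pi (a b : M) :
  nabla_join (nabla_pi a) (nabla_pi b) = nabla_pi (a + b).
Proof.
have [ra ar] := repr_asymp a; have [rb br] := repr_asymp b.
apply/eqP/nabla_eqP; split; apply: propto_add.
- exact: propto_trans ra (propto_addl _ _).
- exact: propto_trans rb (propto_addr _ _).
- exact: propto_trans ar (propto_addl _ _).
- exact: propto_trans br (propto_addr _ _).
Qed.

Lemma nabla_leUx (x y z : nabla M) :
  (nabla_join x y <= z)%O = (x <= z)%O && (y <= z)%O.
Proof.
have [[a ->] [b ->] [c ->]] := And3 (nabla_piP x) (nabla_piP y) (nabla_piP z).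
rewrite nabla_join_pi !nabla_leE.
apply/asboolP/andP => [h|[/asboolP xz /asboolP yz]].
- split; apply/asboolP; apply: (propto_trans _ h).
  + exact: propto_addl.
  + exact: propto_addr.
- exact: propto_add.
Qed.

HB.instance Definition _ :=
  Order.POrder_isJoinSemilattice.Build nabla_display (nabla M) nabla_leUx.

Lemma nabla_le0x (x : nabla M) : (nabla_pi 0 <= x)%O.
Proof.
by have [a ->] := nabla_piP x; rewrite nabla_leE; apply/asboolP; exact: propto0.
Qed.

HB.instance Definition _ :=
  Order.hasBottom.Build nabla_display (nabla M) nabla_le0x.

Lemma nabla_joinE (a b : M) :
  (nabla_pi a `|` nabla_pi b)%O = nabla_pi (a + b).
Proof. exact: nabla_join_pi. Qed.

Lemma nabla_botE : (\bot)%O = nabla_pi 0. Proof. by []. Qed.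

End Nabla.

(* omega_1 is realized as the set of those elements of a fixed well-ordering of
   the uncountable type [set nat] that have countably many predecessors.  The
   lemmas [omega1_wf], [omega1_initial_countable] and [omega1_uncountable]
   characterize its order type. *)
Definition wo_nat : rel (set nat) := sval (well_ordering_principle (set nat)).

Definition countable_initial (x : set nat) : bool :=
  `[< countable [set y | wo_nat y x && (y != x)] >].

Definition omega1 : Type := {x : set nat | countable_initial x}.

Fact omega1_display : Order.disp_t. Proof. exact: (Order.Disp tt tt). Qed.

HB.instance Definition _ := [isSub of omega1 for @sval _ countable_initial].
HB.instance Definition _ := [Choice of omega1 by <:].

Lemma wo_natP : well_order wo_nat.
Proof. exact: (svalP (well_ordering_principle (set nat))). Qed.

Lemma wo_nat_chain : wo_chain wo_nat predT.
Proof. by move=> A _; exact: wo_natP. Qed.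

Lemma wo_nat_refl : reflexive wo_nat.
Proof. by move=> x; exact: (wo_chain_reflexive wo_nat_chain). Qed.

Lemma wo_nat_anti : antisymmetric wo_nat.
Proof. by move=> x y; exact: (wo_chain_antisymmetric wo_nat_chain). Qed.

Lemma wo_nat_total : total wo_nat.
Proof. by move=> x y; exact: (wo_chainW wo_nat_chain). Qed.

Lemma wo_nat_trans : transitive wo_nat.
Proof.
move=> y x z xy yz.
have [|m [[mA mle] _]] := wo_natP (A := [pred t | t \in [:: x; y; z]]).
  by exists x; rewrite inE /= in_cons eqxx.
have mx : wo_nat m x by apply: mle; rewrite !inE eqxx.
have my : wo_nat m y by apply: mle; rewrite !inE eqxx orbT.
have mz : wo_nat m z by apply: mle; rewrite !inE eqxx !orbT.
move: mA; rewrite !inE => /or3P[] /eqP mE; subst m => //.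
- by have -> : x = y by apply/wo_nat_anti; rewrite xy.
- by have <- : y = z by apply/wo_nat_anti; rewrite yz.
Qed.

Definition omega1_le (a b : omega1) : bool := wo_nat (val a) (val b).

Lemma omega1_le_refl : reflexive omega1_le.
Proof. by move=> a; exact: wo_nat_refl. Qed.

Lemma omega1_le_anti : antisymmetric omega1_le.
Proof. by move=> a b ab; apply/val_inj/wo_nat_anti. Qed.

Lemma omega1_le_trans : transitive omega1_le.
Proof. by move=> a b c; exact: wo_nat_trans. Qed.

HB.instance Definition _ := Order.Le_isPOrder.Build omega1_display omega1
  omega1_le_refl omega1_le_anti omega1_le_trans.

Lemma omega1_le_total : total (<=%O : rel omega1).
Proof. by move=> a b; exact: wo_nat_total. Qed.

HB.instance Definition _ :=
  Order.POrder_isTotal.Build omega1_display omega1 omega1_le_total.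

Lemma omega1_wf (A : set omega1) :
  A !=set0 -> exists2 m, A m & forall a, A a -> (m <= a)%O.
Proof.
move=> [x Ax].
pose A' : {pred set nat} := fun t => `[< exists2 a, A a & val a = t >].
have [|m [[/asboolP[m0 Am0 m0E] mle] _]] := wo_natP (A := A').
  by exists (val x); apply/asboolP; exists x.
exists m0 => // a Aa; rewrite /Order.le /= /omega1_le m0E.
by apply: mle; apply/asboolP; exists a.
Qed.

Lemma omega1_initial_countable (a : omega1) : countable [set b | (b < a)%O].
Proof.
have /asboolP/countable_injP[f finj] := valP a.
apply/countable_injP; exists (fun b => f (val b)) => b c.
rewrite !inE /= => ba ca fbc; apply/val_inj/finj => //; rewrite inE /=.
- by move: ba; rewrite lt_neqAle andbC.
- by move: ca; rewrite lt_neqAle andbC.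
Qed.

Lemma set_nat_uncountable : ~ countable [set: set nat].
Proof.
move=> /countable_injP[f finj].
pose A : set nat := [set n | exists X, f X = n /\ ~ X n].
have AfA : A (f A) <-> ~ A (f A).
  split=> [[X [fXA nX]]|nA]; last by exists A.
  rewrite -fXA in nX *.
  by have -> : A = X by apply: finj; rewrite ?inE // fXA.
have nA : ~ A (f A) by move=> h; exact: (AfA.1 h h).
exact: (nA (AfA.2 nA)).
Qed.

Lemma omega1_uncountable : ~ countable [set: omega1].
Proof.
move=> /countable_injP[f finj]; apply: set_nat_uncountable.
pose A : {pred set nat} := fun x => ~~ countable_initial x.
have countA (B : set (set nat)) : (forall x, B x -> countable_initial x) ->
    countable B.
  move=> BC; apply/countable_injP.
  exists (fun x => oapp f 0%N (insub x : option omega1)) => x y.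
  rewrite !inE => /BC xC /BC yC; rewrite !insubT /= => fxy.
  by have /(congr1 val) := finj _ _ (in_setT _) (in_setT _) fxy.
case: (pselect (nonempty A)) => [/wo_natP[m [[mA mle] _]]|A0]; last first.
  apply: countA => x _; case: (boolP (countable_initial x)) => // xA.
  by case: A0; exists x.
case/negP: mA; apply/asboolP/countA => x /andP[xm xneqm].
case: (boolP (countable_initial x)) => // xA.
case/eqP: xneqm; apply: wo_nat_anti; rewrite xm; exact: mle.
Qed.

Lemma omega1_nonempty : [set: omega1] !=set0.
Proof.
apply/set0P/eqP => omega1_0; apply: omega1_uncountable.
by rewrite omega1_0; exact: countable0.
Qed.

Definition boolean_subalgebra (T : Type) (G : set (set T)) : Prop :=
  [/\ G set0,
      forall x y, G x -> G y -> G (x `|` y) &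
      forall x, G x -> G (~` x)].

(* The ordinal [a], viewed as the set of smaller ordinals. *)
Definition initial (a : omega1) : set omega1 := [set b | (b < a)%O].

(* The bounds of [i : interval omega1] may be infinite; as [omega1] is
   well-ordered, every order-convex subset of it has the form [[set` i]]. *)
Definition B_omega1 : set (set omega1) :=
  smallest (@boolean_subalgebra omega1)
    (range (fun i : interval omega1 => [set` i])).

Definition I_omega1 : set (set omega1) :=
  [set x | B_omega1 x /\ exists a, x `<=` initial a].

Definition F_omega1 : set (set omega1) :=
  [set x | B_omega1 x /\ exists a, ~` initial a `<=` x].

Definition D_omega1 : set (set omega1) := [set x | finite_set x \/ x = setT].

Definition Dm_omega1 : set (set omega1) := D_omega1 `\ set0.

Definition S_omega1_set : set (set omega1 * set omega1) :=
  ([set set0] `*` I_omega1) `|` (Dm_omega1 `*` F_omega1).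

Definition S_omega1 : Type := {p : set omega1 * set omega1 | p \in S_omega1_set}.

Lemma B_omega1_algebra : boolean_subalgebra B_omega1.
Proof.
split.
- by move=> G [[]].
- by move=> x y Bx By G GB; case: (GB) => -[_ GU _] _; apply: GU; [exact: Bx|exact: By].
- by move=> x Bx G GB; case: (GB) => -[_ _ GC] _; apply: GC; exact: Bx.
Qed.

Lemma I_omega1U x y : I_omega1 x -> I_omega1 y -> I_omega1 (x `|` y).
Proof.
have [_ BU _] := B_omega1_algebra.
move=> [Bx [a xa]] [By [b yb]]; split; first exact: BU.
exists (Order.max a b) => t [/xa|/yb]; rewrite /initial /= lt_max => -> //.
by rewrite orbT.
Qed.

Lemma F_omega1Ul x y : F_omega1 x -> B_omega1 y -> F_omega1 (x `|` y).
Proof.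
have [_ BU _] := B_omega1_algebra.
by move=> [Bx [a xa]] By; split; [exact: BU|exists a => t /xa; left].
Qed.

Lemma Dm_omega1U x y : Dm_omega1 x -> Dm_omega1 y -> Dm_omega1 (x `|` y).
Proof.
move=> [Dx x0] [Dy _]; split; last first.
  by rewrite /= setU_eq0 => -[x0' _]; exact: x0.
case: Dx => [fx|->]; last by right; rewrite setTU.
case: Dy => [fy|->]; last by right; rewrite setUT.
by left; rewrite finite_setU.
Qed.

Lemma S_omega1_setU p q : S_omega1_set p -> S_omega1_set q ->
  S_omega1_set (p.1 `|` q.1, p.2 `|` q.2).
Proof.
case: p q => [p1 p2] [q1 q2] /= [[/= -> Ip]|[/= Dp Fp]] [[/= -> Iq]|[/= Dq Fq]].
- by left; split; [exact: setU0|exact: I_omega1U].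
- by right; rewrite set0U (setUC p2); split=> //=; apply: F_omega1Ul => //; case: Ip.
- by right; rewrite setU0; split=> //=; apply: F_omega1Ul => //; case: Iq.
- by right; split; [exact: Dm_omega1U|apply: F_omega1Ul => //; case: Fq].
Qed.

Lemma S_omega1_set0 : S_omega1_set (set0, set0).
Proof.
have [B0 _ _] := B_omega1_algebra; have [a _] := omega1_nonempty.
by left; split=> //=; split=> //; exists a.
Qed.

Fact S_omega1_display : Order.disp_t. Proof. exact: (Order.Disp tt tt). Qed.

HB.instance Definition _ :=
  [isSub of S_omega1 for @sval _ (fun p => p \in S_omega1_set)].
HB.instance Definition _ := [Choice of S_omega1 by <:].

Definition S_omega1_le (p q : S_omega1) : bool :=
  `[< (val p).1 `<=` (val q).1 /\ (val p).2 `<=` (val q).2 >].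

Lemma S_omega1_le_refl : reflexive S_omega1_le.
Proof. by move=> p; apply/asboolP; split. Qed.

Lemma S_omega1_le_anti : antisymmetric S_omega1_le.
Proof.
move=> p q /andP[/asboolP[pq1 pq2] /asboolP[qp1 qp2]]; apply: val_inj.
by rewrite [LHS]surjective_pairing [RHS]surjective_pairing; congr pair;
  apply/seteqP; split.
Qed.

Lemma S_omega1_le_trans : transitive S_omega1_le.
Proof.
move=> q p r /asboolP[pq1 pq2] /asboolP[qr1 qr2]; apply/asboolP; split.
- exact: subset_trans pq1 qr1.
- exact: subset_trans pq2 qr2.
Qed.

HB.instance Definition _ := Order.Le_isPOrder.Build S_omega1_display S_omega1
  S_omega1_le_refl S_omega1_le_anti S_omega1_le_trans.

Definition S_omega1_join (p q : S_omega1) : S_omega1 :=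
  exist _ ((val p).1 `|` (val q).1, (val p).2 `|` (val q).2)
    (mem_set (S_omega1_setU (set_mem (valP p)) (set_mem (valP q)))).

Lemma S_omega1_leUx (p q r : S_omega1) :
  (S_omega1_join p q <= r)%O = (p <= r)%O && (q <= r)%O.
Proof.
apply/asboolP/andP => /= [[]|[/asboolP[pr1 pr2] /asboolP[qr1 qr2]]].
- rewrite !subUset => -[pr1 qr1] [pr2 qr2].
  by split; apply/asboolP.
- by rewrite !subUset.
Qed.

HB.instance Definition _ := Order.POrder_isJoinSemilattice.Build
  S_omega1_display S_omega1 S_omega1_leUx.

Definition S_omega1_bot : S_omega1 := exist _ (set0, set0) (mem_set S_omega1_set0).

Lemma S_omega1_le0x (p : S_omega1) : (S_omega1_bot <= p)%O.
Proof. by apply/asboolP; split; exact: sub0set. Qed.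

HB.instance Definition _ :=
  Order.hasBottom.Build S_omega1_display S_omega1 S_omega1_le0x.

Definition isomorphic (d1 d2 : Order.disp_t)
    (S : bJoinSemilatticeType d1) (T : bJoinSemilatticeType d2) : Prop :=
  exists f : S -> T,
    [/\ bijective f, f \bot%O = \bot%O & {morph f : x y / (x `|` y)%O}].

(* Main.v *)
(* Let [u] be the order-unit. For each point [l] of [omega1] write [u = p + q]
   with [p] supported on [(set0, [set l])] and [q] off [l], and for each [xi]
   pick [c <= u] of support [([set xi], X)] with [X] cofinal. Since a countable
   subset of [omega1] is bounded, there is one [n] depending only on [xi] such
   that [p <= n c] for all large [l]; by uncountability the same [n] serves
   [n + 1] distinct indices [xi]. Elements [c] with distinct [xi] overlap only
   in a bounded set, so modulo bounded parts their sum is still below [u], and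
   for large [l] this gives [(n + 1) p <= n u], hence [(n + 1) p <= n p] as [p]
   and [q] are orthogonal. Finite stable rank then forces [p] to be
   negligible. *)
Require Import Defs.
From HB Require Import structures.
From mathcomp Require Import all_boot all_order all_algebra.
From mathcomp Require Import wochoice all_classical.

Import Order.TTheory GRing.Theory.
Local Open Scope classical_set_scope.
Local Open Scope ring_scope.

(** * Countability arguments on [omega1] *)

Lemma omega1_seq_bounded (l : nat -> omega1) : exists m, forall n, (l n < m)%O.
Proof.
apply: contrapT => /forallNP nbd; apply: omega1_uncountable.
(* For an unbounded [l] these countable segments cover [omega1]. *)
have lC n : countable [set b | (b <= l n)%O].
  have -> : [set b | (b <= l n)%O] =
      \bigcup_(c in [set: bool]) if c then [set l n] else [set b | (b < l n)%O].
    apply/seteqP; split=> b /=; last by case=> -[_ /= ->|_ /ltW].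
    by rewrite le_eqVlt => /predU1P[->|ltb]; [exists true|exists false].
  apply: bigcup_countable => // -[] _; last exact: omega1_initial_countable.
  exact/finite_set_countable.
have -> : [set: omega1] = \bigcup_(n in setT) [set b | (b <= l n)%O].
  apply/seteqP; split=> // b _.
  have /existsNP[n /negP] := nbd b; rewrite -leNgt => bn.
  by exists n.
exact: bigcup_countable.
Qed.

(** A countable union of finite sets is countable, so some [G n] is infinite. *)
Lemma omega1_pigeonhole (G : nat -> set omega1) :
  (forall x, exists n, G n x) ->
  exists n, forall m, exists2 s, uniq s & size s = m /\ {in s, forall x, G n x}.
Proof.
move=> Gcov; have [n Gn] : exists n, ~ finite_set (G n).
  apply: contrapT => /forallNP fG; apply: omega1_uncountable.
  have -> : [set: omega1] = \bigcup_(n in setT) G n.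
    by apply/seteqP; split=> // x _; have [n] := Gcov x; exists n.
  by apply: bigcup_countable => // n _; exact: finite_set_countable (contrapT (fG n)).
exists n; elim=> [|m [s us [sm sG]]]; first by exists [::].
have [x Gx xs] : exists2 x, G n x & x \notin s.
  apply: contrapT => nx; apply: Gn; apply: sub_finite_set (finite_seq s) => x Gx.
  by apply: contrapT => /= /negP xs; apply: nx; exists x.
exists (x :: s); first by rewrite /= xs.
split=> [|y]; first by rewrite /= sm.
by rewrite in_cons => /predU1P[->//|/sG].
Qed.

Lemma B_omega1_interval (i : interval omega1) : B_omega1 [set` i].
Proof. by move=> G [_ Gi]; apply: Gi; exists i. Qed.

Lemma I_omega1_interval (a b : omega1) : I_omega1 [set` `[a, b[].
Proof.
split; first exact: B_omega1_interval.
by exists b => c; rewrite /initial /= in_itv /= => /andP[].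
Qed.

Lemma I_omega1_set1 (a : omega1) : I_omega1 [set a].
Proof.
split; first by rewrite -set_itv1; exact: B_omega1_interval.
have [b ab] := omega1_seq_bounded (fun=> a); exists b => c -> /=.
exact: (ab 0%N).
Qed.

Lemma F_omega1_setC X : I_omega1 X -> F_omega1 (~` X).
Proof.
have [_ _ BC] := B_omega1_algebra.
move=> [BX [a Xa]]; split; first exact: BC.
by exists a; exact: subsetC.
Qed.

(** * Orthogonality and stable rank in Riesz monoids *)

Section RieszMonoid.
Variable M : nmodType.
Hypothesis rieszM : riesz_monoid M.
Implicit Types a b c p q x y u : M.

Lemma algle_mulrS_mono p n : algle (p *+ n.+1) (p *+ n) ->
  forall m, algle (p *+ m) (p *+ n).
Proof.
move=> pn; elim=> [|m IH]; first by exists (p *+ n); rewrite add0r.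
apply: algle_trans pn; rewrite !mulrS.
by apply: algleD IH; exact: algle_refl.
Qed.

Lemma propto0_algle b x : propto x 0 -> algle (b + x) b.
Proof. by move=> [n [_ [z]]]; rewrite mul0rn => xz; exists z; rewrite -addrA xz addr0. Qed.

(** Riesz splitting gives [x = a' + b'], where [b'] lies below both [x] and [b] and is therefore
    negligible. *)
Lemma algle_orthogonal x a b :
  (forall y, algle y x -> algle y b -> propto y 0) ->
  algle x (a + b) -> algle x a.
Proof.
move=> orth /rieszM[a' [b' [a'a b'b xE]]]; rewrite xE.
apply: algle_trans a'a; apply: propto0_algle; apply: orth => //.
by exists a'; rewrite addrC.
Qed.

(* Stable rank at most [k] passes from [u] to its summand [p], up to an error in the
   complement [q]; here the error vanishes since [p] and [q] are orthogonal. *)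
Lemma stable_rank_absorb k u p q n : (0 < k)%N -> stable_rank_le k u ->
  p + q = u ->
  (forall m i y, algle y (p *+ m) -> algle y (q *+ i) -> propto y 0) ->
  algle (p *+ n.+1) (p *+ n) -> propto p 0.
Proof.
move=> k0 sr pqu orth /algle_mulrS_mono; elim: n => [|n IH] pn.
  by exists 1%N; split => //; have := pn 1%N; rewrite !mulr0n mul0rn.
(* Each round lowers the common bound on all multiples of [p] from [n + 1] to [n] copies of [p]. *)
apply: IH => m; apply: (algle_orthogonal _ _ (q *+ k.-1)); first exact: orth.
have [z zE] := pn (k + m)%N.
apply: (@algle_trans _ (p *+ m + z)); first by exists z.
(* The stable rank is applied to [k u + (m p + z) = u + (n p + (k - 1) q)]. *)
apply: sr; rewrite -pqu mulrnDl [LHS]addrACA -mulrnDr [LHS]addrCA zE [RHS]addrACA -!mulrS.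
by rewrite (prednK k0) addrC.
Qed.
End RieszMonoid.

(** * Supports of elements in [S_omega1] *)

Section Support.
Variables (M : nmodType) (sigma : M -> S_omega1).
Hypothesis rieszM : riesz_monoid M.
Hypothesis proptoE : forall x y, propto x y <-> (sigma x <= sigma y)%O.
Hypothesis sigmaD : forall x y, sigma (x + y) = (sigma x `|` sigma y)%O.
Hypothesis sigma_surj : forall s, exists x, sigma x = s.
Implicit Types a b c p q x y u : M.

(* [S_omega1] consists of pairs: [lim] is the first component, which records the
   behaviour at the limit [omega1], and [loc] the second. *)
Let lim x : set omega1 := (val (sigma x)).1.
Let loc x : set omega1 := (val (sigma x)).2.

Lemma support_inP x : S_omega1_set (lim x, loc x).
Proof. by have /set_mem := valP (sigma x); rewrite -surjective_pairing. Qed.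

Lemma support_surj D X : S_omega1_set (D, X) ->
  exists x, lim x = D /\ loc x = X.
Proof.
move=> SDX; have [x sx] := sigma_surj (exist _ (D, X) (mem_set SDX)).
by exists x; rewrite /lim /loc sx.
Qed.

Lemma proptoP x y : propto x y <-> lim x `<=` lim y /\ loc x `<=` loc y.
Proof. by rewrite proptoE; split=> /asboolP. Qed.

Lemma algle_support x y : algle x y -> lim x `<=` lim y /\ loc x `<=` loc y.
Proof. by move=> xy; apply/proptoP; exists 1%N. Qed.

Lemma limD x y : lim (x + y) = lim x `|` lim y.
Proof. by rewrite /lim sigmaD. Qed.

Lemma locD x y : loc (x + y) = loc x `|` loc y.
Proof. by rewrite /loc sigmaD. Qed.

Lemma mulrn_support x n : lim (x *+ n) `<=` lim x /\ loc (x *+ n) `<=` loc x.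
Proof. by apply/proptoP; exists n.+1; split=> //; exists x; rewrite mulrSr. Qed.

Lemma lim0 : lim 0 = set0.
Proof.
have [x [x0 _]] := support_surj _ _ S_omega1_set0.
by rewrite -subset0 -x0; have /proptoP[] := propto0 x.
Qed.

Lemma loc0 : loc 0 = set0.
Proof.
have [x [_ x0]] := support_surj _ _ S_omega1_set0.
by rewrite -subset0 -x0; have /proptoP[] := propto0 x.
Qed.

Lemma algle_disjoint x a b : lim x = set0 -> loc x `&` loc b = set0 ->
  algle x (a + b) -> algle x a.
Proof.
move=> x0 xb; apply: algle_orthogonal => // y /algle_support[ylx yx].
move=> /algle_support[_ yb]; apply/proptoP; rewrite lim0 loc0; split; first by rewrite -x0.
by rewrite -xb => l yl; split; [exact: yx|exact: yb].
Qed.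

(** Riesz splits [x] into pieces below [u], and one of them must carry [xi]. *)
Lemma algle_mulrn_summand x u : order_unit u ->
  forall xi, lim x xi -> exists2 c, algle c x /\ algle c u & lim c xi.
Proof.
move=> /(_ x) [n [_]] xu xi; elim: n x xu => [|n IH] x.
  rewrite mulr0n => /algle_support[xl _] /xl; by rewrite lim0.
rewrite mulrS => /rieszM[a [b [au bnu ->]]]; rewrite limD => -[axi|bxi].
  by exists a => //; split=> //; exists b.
have [c [cb cu] cxi] := IH b bnu bxi; exists c => //; split=> //.
by apply: algle_trans cb _; exists a; rewrite addrC.
Qed.

Section OrderUnit.
Variable u : M.
Hypothesis u_unit : order_unit u.

Lemma support_unit : lim u = setT /\ loc u = setT.
Proof.
have [x [xl xL]] : exists x, lim x = setT /\ loc x = setT.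
  apply: support_surj; right; split => /=; first split; first by right.
    by apply/eqP/set0P; exact: omega1_nonempty.
  by rewrite -setC0; apply: F_omega1_setC; case: S_omega1_set0 => -[] // [_ /(_ erefl)].
have /proptoP[ul uL] := u_unit x.
by split; rewrite -subTset; [rewrite -xl|rewrite -xL].
Qed.

(** Refining [u] below a multiple of [a + b], with [a] supported on [X] and [b] off [X], bounds both
    supports; since they cover [omega1], the bounds are attained. *)
Lemma unit_split X : I_omega1 X ->
  exists p q, [/\ p + q = u, lim p = set0, loc p = X & loc q = ~` X].
Proof.
move=> IX; have [ul uL] := support_unit.
have [a [al aL]] : exists a, lim a = set0 /\ loc a = X.
  by apply: support_surj; left.
have [b [bl bL]] : exists b, lim b = setT /\ loc b = ~` X.
  apply: support_surj; right; split => /=; last exact: F_omega1_setC.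
  by split; [right|apply/eqP/set0P; exact: omega1_nonempty].
have /proptoP[n [_]] : lim u `<=` lim (a + b) /\ loc u `<=` loc (a + b).
  by rewrite limD locD al bl aL bL setUT setUv.
rewrite mulrnDl => /rieszM[p [q [/algle_support[pl pL] /algle_support[_ qL] uE]]].
have [anl anL] := mulrn_support a n; have [_ bnL] := mulrn_support b n.
have pX : loc p `<=` X by rewrite -aL; exact: subset_trans anL.
have qX : loc q `<=` ~` X by rewrite -bL; exact: subset_trans bnL.
have pqT : loc p `|` loc q = setT by rewrite -locD -uE.
exists p, q; split=> //.
- by rewrite -subset0 -al; exact: subset_trans anl.
- apply/seteqP; split=> // l Xl.
  have : (loc p `|` loc q) l by rewrite pqT.
  by case=> // /qX.
- apply/seteqP; split=> // l Xl.
  have : (loc p `|` loc q) l by rewrite pqT.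
  by case=> // /pX.
Qed.

(** * Domination of the point summands [p l] *)

Section Points.
Variables p q : omega1 -> M.
Hypothesis pqu : forall l, p l + q l = u.
Hypothesis lim_p : forall l, lim (p l) = set0.
Hypothesis loc_p : forall l, loc (p l) = [set l].
Hypothesis loc_q : forall l, loc (q l) = ~` [set l].

Definition eventually_dominates n xi :=
  exists2 c, algle c u /\ lim c `<=` [set xi] &
    exists m, forall l, (m <= l)%O -> algle (p l) (c *+ n).

Lemma eventually_dominates_ex xi : exists n, eventually_dominates n xi.
Proof.
have [g [gl _]] : exists x, lim x = [set xi] /\ loc x = setT.
  apply: support_surj; right; split => /=.
    by split; [left|apply/eqP/set0P; exists xi].
  by rewrite -setC0; apply: F_omega1_setC; case: S_omega1_set0 => -[] // [_ /(_ erefl)].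
have [|c [/algle_support[cg _] cu] cxi] := @algle_mulrn_summand g u u_unit xi.
  by rewrite gl.
rewrite gl in cg.
(* A nonempty first component forces the second one into [F_omega1]. *)
have [m mc] : exists m, ~` initial m `<=` loc c.
  by case: (support_inP c) => -[/= cl]; [rewrite cl in cxi|case].
apply: contrapT => /forallNP ndom.
(* If every [n] fails, the failures [l n] all lie in one interval from [m] to [b]; a single [al]
   supported there is below some [n c], which refutes the failure at that [n]. *)
have /choice[l lP] : forall n, exists l, (m <= l)%O /\ ~ algle (p l) (c *+ n).
  move=> n; apply: contrapT => /forallNP nl; apply: (ndom n); exists c => //.
  exists m => l ml; apply: contrapT => pl; exact: (nl l).
have [b lb] := omega1_seq_bounded l.
have [al [be [abu all alL beL]]] := unit_split _ (I_omega1_interval m b).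
have /proptoP[n [_ alc]] : lim al `<=` lim c /\ loc al `<=` loc c.
  rewrite all alL; split=> // x; rewrite /= in_itv /= => /andP[mx _].
  by apply: mc; rewrite /initial /= leNgt in mx *; exact/negP.
have [ml] := lP n; apply; apply: algle_trans alc.
apply: (@algle_disjoint _ _ be) => //; last first.
  by rewrite abu -(pqu (l n)); exists (q (l n)).
rewrite loc_p beL; rewrite -subset0 => x [/= ->]; apply.
by rewrite in_itv /= ml lb.
Qed.

(* The sum [d] is built by discarding from each new [c] its common part with the
   previous ones, whose support is bounded. *)
Lemma sum_dominates n s : uniq s ->
  (forall xi, xi \in s -> eventually_dominates n xi) ->
  exists2 d, algle d u /\ lim d `<=` [set` s] &
    exists m, forall l, (m <= l)%O -> algle (p l *+ size s) (d *+ n).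
Proof.
elim: s => [|xi s IH] /=.
  have [m _] := omega1_nonempty; move=> _ _; exists 0.
    by rewrite lim0; split=> //; exists u; rewrite add0r.
  by exists m => l _; exists (0 *+ n); rewrite mulr0n add0r.
move=> /andP[xis us] dom.
have [|d [[v dvu] ds] [m md]] := IH us.
  by move=> z zs; apply: dom; rewrite in_cons zs orbT.
have [|c [cu cxi] [m' mc]] := dom xi; first exact: mem_head.
move: (cu); rewrite -{1}dvu => /rieszM[x [y [xd yv cE]]].
have xl : lim x = set0.
  rewrite -subset0 => z xz.
  have zs : z \in s by apply: ds; case/algle_support: xd => + _; apply.
  have : lim c z by rewrite cE limD; left.
  by move=> /cxi /= zxi; rewrite zxi (negbTE xis) in zs.
(* An empty [lim x] puts [loc x] in [I_omega1]. *)
have [b xb] : exists b : omega1, loc x `<=` initial b.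
  by case: (support_inP x) => -[/=]; [move=> _ []|case=> _ /(_ xl)].
exists (d + y).
  split; first by rewrite -dvu; apply: algleD => //; exact: algle_refl.
  rewrite limD => z [/ds /= zs|yz] /=; first by rewrite in_cons zs orbT.
  by have : lim c z by [rewrite cE limD; right]; move=> /cxi /= ->; exact: mem_head.
exists (Order.max m (Order.max m' b)) => l; rewrite !ge_max => /and3P[ml ml' bl].
rewrite mulrS addrC mulrnDl; apply: algleD; first exact: md.
(* Beyond [b] the point [l] misses [loc x], so [p l] below [n c = n y + n x] is already below
   [n y]. *)
apply: (@algle_disjoint _ _ (x *+ n)) => //; last first.
  by rewrite -mulrnDl addrC -cE; exact: mc.
rewrite loc_p; rewrite -subset0 => z [/= ->].
have [_ xn] := mulrn_support x n.
by move=> /xn /xb; rewrite /initial /= ltNge bl.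
Qed.

Lemma points_no_finite_stable_rank : ~ finite_stable_rank u.
Proof.
move=> [k [k0 sr]].
have [n nP] := omega1_pigeonhole (fun n => [set xi | eventually_dominates n xi])
  eventually_dominates_ex.
have [s us [sn sdom]] := nP n.+1.
have [d [du _] [m /(_ m (lexx m))]] := sum_dominates n s us sdom.
rewrite sn => pd.
have orth i j y : algle y (p m *+ i) -> algle y (q m *+ j) -> propto y 0.
  move=> /algle_support[ypl ypL] /algle_support[_ yqL].
  have [pil piL] := mulrn_support (p m) i; have [_ qjL] := mulrn_support (q m) j.
  apply/proptoP; rewrite lim0 loc0; split.
    by rewrite -(lim_p m); exact: subset_trans pil.
  move=> z yz; have := qjL _ (yqL _ yz); rewrite loc_q; apply.
  by rewrite -(loc_p m); exact/piL/ypL.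
(* The chain is [(n + 1) p <= n d <= n u = n p + n q]. *)
have pn : algle (p m *+ n.+1) (p m *+ n).
  apply: (algle_orthogonal M rieszM _ _ (q m *+ n)) => [y|]; first exact: orth.
  by rewrite -mulrnDl pqu; apply: algle_trans pd _; exact: algleMn.
have /proptoP[_] := stable_rank_absorb M rieszM k u (p m) (q m) n k0 sr (pqu m) orth pn.
by rewrite loc_p loc0 => /(_ m erefl).
Qed.

End Points.

Lemma no_finite_stable_rank : ~ finite_stable_rank u.
Proof.
have /choice[pq pqP] : forall l, exists pq : M * M, [/\ pq.1 + pq.2 = u,
    lim pq.1 = set0, loc pq.1 = [set l] & loc pq.2 = ~` [set l]].
  by move=> l; have [p [q ?]] := unit_split _ (I_omega1_set1 l); exists (p, q).
apply: (@points_no_finite_stable_rank (fst \o pq) (snd \o pq)) => l /=;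
  by case: (pqP l).
Qed.

End OrderUnit.
End Support.

Theorem corollary5p2 (M : nmodType) :
  riesz_monoid M ->
  (exists e : M, order_unit e /\ finite_stable_rank e) ->
  ~ isomorphic S_omega1 (nabla M).
Proof.
move=> rieszM [u [u_unit u_sr]] [f [[g fK gK] _ fU]].
have f_le s t : (f s <= f t)%O = (s <= t)%O.
  by rewrite !leEjoin -fU (can_eq fK).
(* The inverse isomorphism turns classes into supports. *)
pose sigma (x : M) := g (nabla_pi x).
have sigma_le x y : propto x y <-> (sigma x <= sigma y)%O.
  by rewrite -f_le !gK nabla_leE; split=> /asboolP.
have sigmaD x y : sigma (x + y) = (sigma x `|` sigma y)%O.
  by apply: (can_inj fK); rewrite fU !gK nabla_joinE.
have sigma_surj s : exists x, sigma x = s.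
  by have [x fs] := nabla_piP (f s); exists x; rewrite /sigma -fs fK.
exact: (no_finite_stable_rank _ _ rieszM sigma_le sigmaD sigma_surj _ u_unit u_sr).
Qed.
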